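(* Let $(A,\circ,\mathcal B(\cdot,\cdot))$ be a quadratic Novikov algebra and $\varphi:A\to A^*$ the invertible linear map defined by $\langle\varphi(a),b\rangle=\mathcal B(a,b)$ for $a,b\in A$. Let $\kappa\in\mathbf k$. Suppose that $T$ is a linear endomorphism of $A$, that $\beta$ is a balanced $A$-bimodule homomorphism from $(A,L_A,R_A)$ to $(A,L_A,R_A)$, and that $\beta$ is self-adjoint with respect to $\mathcal B(\cdot,\cdot)$. Put $P_T=T\varphi^{-1}:A^*\to A$ and $P_\beta=\beta\varphi^{-1}:A^*\to A$. Then the following conclusions hold. (i) $T$ is an extended $\mathcal O$-operator of weight $0$ with extension $\beta$ of mass $(\kappa,0)$ on $(A,\circ)$ associated to $(A,\circ,L_A,R_A)$ if and only if $P_T$ is an extended $\mathcal O$-operator of weight $0$ with extension $P_\beta$ of mass $(\kappa,0)$ on $(A,\circ)$ associated to $(A^*,L_{A,\star}^*,-R_A^* )$. (ii) Suppose in addition that $T$ is skew-adjoint with respect to $\mathcal B(\cdot,\cdot)$. Then $\check\delta_\pm=\check P_T\pm\check P_\beta$, regarded as an element of $A\otimes A$, is a solution of the extended Novikov Yang-Baxter equation of mass $\frac{\kappa+1}{4}$ if and only if $T$ is an extended $\mathcal O$-operator of weight $0$ with extension $\beta$ of mass $(\kappa,0)$ on $(A,\circ)$ associated to $(A,\circ,L_A,R_A)$. In particular: - if $\kappa=-1$, then $\check\delta_\pm=\check P_T\pm\check P_\beta$ is a solution of the Novikov Yang-Baxter equation in $A$ if and only if $T$ is an extended $\mathcal O$-operator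 of weight $0$ with extension $\beta$ of mass $(-1,0)$ on $(A,\circ)$ associated to $(A,\circ,L_A,R_A)$; - if $\kappa=0$, then $\check\delta_\pm=\check P_T\pm\check P_\beta$ is a solution of the Novikov Yang-Baxter equation in $A$ if and only if $T$ is a Rota-Baxter operator of weight $0$, i.e. $T(x)\circ T(y)=T(T(x)\circ y+x\circ T(y))$ for all $x,y\in A$.
   Context: $\mathbf k$ is a field of characteristic zero; all vector spaces are finite-dimensional over $\mathbf k$. A Novikov algebra $(A,\circ)$ is a vector space with a bilinear operation satisfying $(a\circ b)\circ c-a\circ(b\circ c)=(b\circ a)\circ c-b\circ(a\circ c)$ and $(a\circ b)\circ c=(a\circ c)\circ b$ for all $a,b,c\in A$. Put $a\star b=a\circ b+b\circ a$, $L_A(a)b=a\circ b$, $R_A(a)b=b\circ a$, $L_{A,\star}=L_A+R_A$. For linear $\psi:A\to\mathrm{End}_{\mathbf k}(V)$, define $\psi^*:A\to\mathrm{End}_{\mathbf k}(V^* )$ by $\langle\psi^*(a)f,v\rangle=-\langle f,\psi(a)v\rangle$. Both $(A,L_A,R_A)$ and $(A^*,L_{A,\star}^*,-R_A^* )$ are bimodules of $(A,\circ)$. A quadratic Novikov algebra is a Novikov algebra with a nondegenerate symmetric bilinear form $\mathcal B$ that is invariant: $\mathcal B(a\circ b,c)=-\mathcal B(b,a\star c)$. A linear map $T:A\to A$ is self-adjoint (skew-adjoint) if $\mathcal B(T(a),b)=\mathcal B(a,T(b))$ (resp. $=-\mathcal B(a,T(b))$) for all $a,b$. For a bimodule $(V,l_A,r_A)$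 of $(A,\circ)$ and a linear map $\beta:V\to A$: $\beta$ is balanced if $l_A(\beta(u))v=r_A(\beta(v))u$ for all $u,v\in V$; $\beta$ is an $A$-bimodule homomorphism to $(A,L_A,R_A)$ if $\beta(l_A(x)u)=x\circ\beta(u)$ and $\beta(r_A(x)u)=\beta(u)\circ x$; $\beta$ is $A$-invariant of mass $\kappa$ if these two identities hold after multiplication by $\kappa$. A linear map $\alpha:V\to A$ is an extended $\mathcal O$-operator of weight $0$ with extension $\beta$ of mass $(\kappa,0)$ on $(A,\circ)$ associated to $V$ if $\beta$ is balanced and $A$-invariant of mass $\kappa$ and $\alpha(u)\circ\alpha(v)-\alpha(l_A(\alpha(u))v+r_A(\alpha(v))u)=\kappa\,\beta(u)\circ\beta(v)$ for all $u,v\in V$ (any product on $V$ plays no role for weight $0$ and mass $(\kappa,0)$). For a linear map $\gamma:A^*\to A$, $\check\gamma\in A\otimes A$ is defined by $\langle a^*\otimes b^*,\check\gamma\rangle=\langle\gamma(a^* ),b^*\rangle$. $\tau(a\otimes b)=b\otimes a$. For $r=\sum_i x_i\otimes y_i$, $r'=\sum_j x'_j\otimes y'_j$: $r_{13}\circ r'_{23}=\sum x_i\otimes x'_j\otimes y_i\circ y'_j$, $r_{12}\star r'_{23}=\sum x_i\otimes y_i\star x'_j\otimes y'_j$, $r_{13}\circ r'_{12}=\sum x_i\circ x'_j\otimes y'_j\otimes y_i$. The extended Novikov Yang-Baxter equation of mass $\epsilon\in\mathbf k$ in $A$ is $r_{13}\circ r_{23}+r_{12}\star r_{23}+r_{13}\circ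 r_{12}=\epsilon\,(r_{13}+(\tau r)_{13})\circ(r_{23}+(\tau r)_{23})$; the Novikov Yang-Baxter equation is the case $\epsilon=0$.
   Formalization: The κ=0 bullet is false as printed (e.g. T=0, β=id on an algebra with nonzero product); instead, for κ=0, the extended equation of mass 1/4 is proved equivalent to T being Rota-Baxter, and the equation of mass 0 only under the added hypothesis β(x)∘β(y)=0 for all x,y. *)

(* Defs.v *)
From HB Require Import structures.
From mathcomp Require Import all_boot all_order all_algebra ring.

Set Implicit Arguments.
Unset Strict Implicit.
Unset Printing Implicit Defensive.

Import GRing.Theory.
Local Open Scope ring_scope.

Lemma linfun_linearE (k : fieldType) (aT rT : vectType k) (f : aT -> rT) :
  linear f -> linfun f =1 f.
Proof.
move=> lin_f; pose H := GRing.isLinear.Build k aT rT *:%R f lin_f.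
pose g : {linear aT -> rT} := HB.pack f H.
exact: (lfunE g).
Qed.

Lemma coord_inj (k : fieldType) (V : vectType k) (u v : V) :
  (forall i, coord (vbasis {:V}) i u = coord (vbasis {:V}) i v) -> u = v.
Proof.
move=> uv; rewrite (coord_vbasis (memvf u)) (coord_vbasis (memvf v)).
by apply: eq_bigr => i _; rewrite uv.
Qed.

HB.mixin Record isNovikov (k : fieldType) A of Vector k A := {
  nov_mul : A -> A -> A;
  nov_mul_linearl : forall b, linear (nov_mul ^~ b);
  nov_mul_linearr : forall a, linear (nov_mul a);
  nov_left_symmetric : forall a b c,
    nov_mul (nov_mul a b) c - nov_mul a (nov_mul b c) =
    nov_mul (nov_mul b a) c - nov_mul b (nov_mul a c);
  nov_right_commutative : forall a b c,
    nov_mul (nov_mul a b) c = nov_mul (nov_mul a c) b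
}.

#[short(type="novikovType")]
HB.structure Definition Novikov (k : fieldType) :=
  {A of Vector k A & isNovikov k A}.

Notation "a ∘ b" := (nov_mul a b) (at level 40, left associativity) : ring_scope.

HB.instance Definition _ (k : fieldType) (A : novikovType k) :=
  bilinear_isBilinear.Build k A A A *:%R *:%R (@nov_mul k A)
    (@nov_mul_linearl k A, @nov_mul_linearr k A).

Definition nov_star (k : fieldType) (A : novikovType k) (a b : A) : A :=
  a ∘ b + b ∘ a.

Notation "a ⋆ b" := (nov_star a b) (at level 40, left associativity) : ring_scope.

Section Bimodules.
Variables (k : fieldType) (A : novikovType k).
Local Notation dual V := 'Hom(V, k^o).

Definition bimodule_axiom (V : vectType k) (l r : 'Hom(A, 'End(V))) : Prop :=
  [/\ forall a b v, l (a ∘ b - b ∘ a) v = l a (l b v) - l b (l a v),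
      forall a b v, l a (r b v) - r b (l a v) = r (a ∘ b) v - r b (r a v),
      forall a b v, l (a ∘ b) v = r b (l a v)
    & forall a b v, r a (r b v) = r b (r a v)].

Record bimodule (V : vectType k) := Bimodule {
  lact : 'Hom(A, 'End(V));
  ract : 'Hom(A, 'End(V));
  bimoduleP : bimodule_axiom lact ract
}.

Definition lmult : 'Hom(A, 'End(A)) := linfun (fun a => linfun (fun b => a ∘ b)).
Definition rmult : 'Hom(A, 'End(A)) := linfun (fun a => linfun (fun b => b ∘ a)).

Lemma lmultE a b : lmult a b = a ∘ b.
Proof.
have E x y : linfun (nov_mul x) y = x ∘ y.
  by rewrite linfun_linearE //; apply: nov_mul_linearr.
rewrite /lmult linfun_linearE ?E // => c x y.
by apply/lfunP=> v; rewrite add_lfunE scale_lfunE !E linearPl.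
Qed.

Lemma rmultE a b : rmult a b = b ∘ a.
Proof.
have E x y : linfun (fun z => z ∘ x) y = y ∘ x.
  by rewrite linfun_linearE //; apply: nov_mul_linearl.
rewrite /rmult linfun_linearE ?E // => c x y.
by apply/lfunP=> v; rewrite add_lfunE scale_lfunE !E linearPr.
Qed.

Definition dual_rep (V : vectType k) (psi : 'Hom(A, 'End(V))) :
    'Hom(A, 'End(dual V)) :=
  linfun (fun a => linfun (fun f : dual V => - (f \o psi a)%VF)).

Lemma dual_repE (V : vectType k) (psi : 'Hom(A, 'End(V))) a (f : dual V) v :
  dual_rep psi a f v = - f (psi a v).
Proof.
have E x g : linfun (fun f : dual V => - (f \o psi x)%VF) g = - (g \o psi x)%VF.
  rewrite linfun_linearE // => c g1 g2.
  by apply/lfunP=> w; rewrite !lfun_simp opprD scalerN.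
rewrite /dual_rep linfun_linearE ?E ?lfun_simp // => c x y.
apply/lfunP=> g; apply/lfunP=> w.
by rewrite !(add_lfunE, scale_lfunE) !E !lfun_simp !linearP /= !lfun_simp
           linearP /= opprD scalerN.
Qed.

Lemma regular_bimodule_axiom : bimodule_axiom lmult rmult.
Proof.
split=> a b v; rewrite !(lmultE, rmultE); last 2 first.
- exact: nov_right_commutative.
- exact: nov_right_commutative.
- apply: coord_inj => i.
  have /(congr1 (coord (vbasis {:A}) i)) := nov_left_symmetric a b v.
  rewrite linearBl /= !raddfB /= => /eqP; rewrite -subr_eq0 => /eqP E.
  by apply/eqP; rewrite -subr_eq0 -E; apply/eqP; ring.
- apply: coord_inj => i.
  have /(congr1 (coord (vbasis {:A}) i)) := nov_left_symmetric a v b.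
  rewrite !raddfB /= => /eqP; rewrite -subr_eq0 => /eqP E.
  by apply/eqP; rewrite -subr_eq0 -oppr0 -E; apply/eqP; ring.
Qed.

Definition regular_bimodule : bimodule A := Bimodule regular_bimodule_axiom.

Lemma coregular_bimodule_axiom :
  bimodule_axiom (dual_rep (lmult + rmult)) (- dual_rep rmult).
Proof.
have: forall a (f : dual A) v, (- dual_rep rmult) a f v = f (v ∘ a).
  by move=> a f v; rewrite 3!opp_lfunE dual_repE rmultE opprK.
have: forall a (f : dual A) v,
    dual_rep (lmult + rmult) a f v = - f (a ∘ v) - f (v ∘ a).
  by move=> a f v; rewrite dual_repE 2!add_lfunE lmultE rmultE raddfD opprD.
move: (dual_rep (lmult + rmult)) (- dual_rep rmult) => l r lE rE.
have RC (f : dual A) a b c : f (a ∘ b ∘ c) = f (a ∘ c ∘ b).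
  by rewrite nov_right_commutative.
have LS (f : dual A) a b c :
    f (a ∘ (b ∘ c)) = f (a ∘ b ∘ c) - f (b ∘ a ∘ c) + f (b ∘ (a ∘ c)).
  have /(congr1 f) := nov_left_symmetric a b c.
  rewrite !raddfB /= => /eqP; rewrite -subr_eq0 => /eqP E.
  by apply/eqP; rewrite -subr_eq0 -oppr0 -E; apply/eqP; ring.
split=> a b f; apply/lfunP=> v.
- rewrite add_lfunE opp_lfunE !lE linearBl linearBr /= !(raddfB f) /=.
  rewrite (LS f v a b) (LS f v b a) (LS f a b v).
  rewrite (RC f a b v) (RC f b a v) (RC f v a b); ring.
- rewrite 2!add_lfunE 2!opp_lfunE !(lE, rE).
  rewrite (LS f v a b) (RC f v a b); ring.
- rewrite rE !lE.
  rewrite (LS f v a b) (RC f a b v) (RC f v a b); ring.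
- by rewrite !rE RC.
Qed.

Definition coregular_bimodule : bimodule (dual A) :=
  Bimodule coregular_bimodule_axiom.

Section ExtendedOOperator.
Variables (V : vectType k) (M : bimodule V).
Implicit Types (alpha beta : 'Hom(V, A)) (kappa : k).

Definition balanced beta : Prop :=
  forall u v, lact M (beta u) v = ract M (beta v) u.

Definition bimodule_hom beta : Prop :=
  forall x u, beta (lact M x u) = x ∘ beta u /\ beta (ract M x u) = beta u ∘ x.

Definition invariant_of_mass kappa beta : Prop :=
  forall x u, kappa *: beta (lact M x u) = kappa *: (x ∘ beta u) /\
              kappa *: beta (ract M x u) = kappa *: (beta u ∘ x).

(* [alpha] has weight 0 and extension [beta] of mass (kappa, 0). *)
Definition extended_O_operator kappa beta alpha : Prop :=
  [/\ balanced beta,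
      invariant_of_mass kappa beta
    & forall u v,
        alpha u ∘ alpha v - alpha (lact M (alpha u) v + ract M (alpha v) u) =
        kappa *: (beta u ∘ beta v)].

End ExtendedOOperator.

Definition rota_baxter (T : 'End(A)) : Prop :=
  forall x y, T x ∘ T y = T (T x ∘ y + x ∘ T y).

End Bimodules.

Arguments lmult {k A}.
Arguments rmult {k A}.
Arguments regular_bimodule {k} A.
Arguments coregular_bimodule {k} A.

Section QuadraticForms.
Variables (k : fieldType) (A : novikovType k) (B : {symmetric A}).
Local Notation dual V := 'Hom(V, k^o).

Definition invariant_form : Prop :=
  forall a b c, B (a ∘ b) c = - B b (a ⋆ c).

Definition self_adjoint (T : 'End(A)) : Prop := forall a b, B (T a) b = B a (T b).
Definition skew_adjoint (T : 'End(A)) : Prop := forall a b, B (T a) b = - B a (T b).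

Definition form_map : 'Hom(A, dual A) :=
  linfun (fun a => linfun (fun b => B a b : k^o)).

Lemma form_mapE a b : form_map a b = B a b.
Proof.
have E x y : linfun (fun b => B x b : k^o) y = B x y.
  by rewrite linfun_linearE // => c u v; rewrite linearPr.
rewrite /form_map linfun_linearE ?E // => c x y.
by apply/lfunP=> v; rewrite add_lfunE scale_lfunE !E linearPl.
Qed.

Lemma form_map_bij : nondegenerate B -> bijective form_map.
Proof.
move=> /eqP B0; have ker0 : lker form_map == 0%VS.
  apply/eqP/vspaceP=> a; rewrite memv_ker -B0; apply/eqP/mem_orthovP => [a0 b _|a0].
    by rewrite -form_mapE a0 zero_lfunE.
  by apply/lfunP=> b; rewrite form_mapE zero_lfunE a0 ?memvf.
exists (form_map^-1)%VF; first exact: lker0_lfunK.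
move=> f; rewrite limg_lfunVK //; suff -> : limg form_map = fullv by rewrite memvf.
apply/eqP; rewrite eqEdim subvf limg_dim_eq ?(eqP ker0) ?capv0 // !dimvf.
by rewrite [X in (X <= _)%N]muln1 leqnn.
Qed.

End QuadraticForms.

(* The tensor product of finite-dimensional spaces, in coordinates with respect
   to the bases [vbasis]; its universal property is [tlift_tens], [tlift_uniq]. *)
Section Tensor.
Variables (k : fieldType) (U V : vectType k).
Local Notation dual V := 'Hom(V, k^o).

Definition tensor : vectType k := 'M[k]_(\dim {:U}, \dim {:V}).

Definition tens (u : U) (v : V) : tensor :=
  \matrix_(i, j) (coord (vbasis {:U}) i u * coord (vbasis {:V}) j v).

(* For bilinear [f], the linear map with [u ⊗ v |-> f u v]. *)
Definition tlift (W : vectType k) (f : U -> V -> W) (t : tensor) : W :=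
  \sum_(i < \dim {:U}) \sum_(j < \dim {:V}) t i j *: f (vbasis {:U})`_i (vbasis {:V})`_j.

Definition tpairing (f : dual U) (g : dual V) : tensor -> k^o :=
  tlift (fun u v => f u * g v : k^o).

(* Characterized by [tpairing f g (tensor_of_hom gamma) = g (gamma f)]. *)
Definition tensor_of_hom (gamma : 'Hom(dual U, V)) : tensor :=
  \sum_(i < \dim {:U}) tens (vbasis {:U})`_i
              (gamma (linfun (coord (vbasis {:U}) i : U -> k^o))).

Lemma tens_linearl v : linear (tens^~ v).
Proof.
by move=> c u1 u2; apply/matrixP=> i j; rewrite !mxE linearP /= mulrDl mulrA.
Qed.

Lemma tens_linearr u : linear (tens u).
Proof.
move=> c v1 v2; apply/matrixP=> i j.
by rewrite !mxE linearP /= mulrDr mulrCA.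
Qed.

Lemma tlift_linear (W : vectType k) (f : U -> V -> W) : linear (tlift f).
Proof.
move=> c s t; rewrite /tlift scaler_sumr -big_split; apply: eq_bigr => i _ /=.
rewrite scaler_sumr -big_split; apply: eq_bigr => j _ /=.
by rewrite !mxE scalerDl scalerA.
Qed.

HB.instance Definition _ (W : vectType k) (f : U -> V -> W) :=
  GRing.isLinear.Build k tensor W *:%R (tlift f) (tlift_linear f).
HB.instance Definition _ (f : dual U) (g : dual V) :=
  GRing.Linear.on (tpairing f g).

Lemma tlift_tens (W : vectType k) (f : U -> V -> W) u v :
  (forall v, linear (f^~ v)) -> (forall u, linear (f u)) ->
  tlift f (tens u v) = f u v.
Proof.
move=> linl linr.
pose F : {bilinear U -> V -> W} := HB.pack f
  (bilinear_isBilinear.Build k U V W *:%R *:%R f (linl, linr)).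
rewrite -[RHS]/(F u v) [in RHS](coord_vbasis (memvf u)) linear_sumlz.
apply: eq_bigr => i _.
rewrite [in RHS](coord_vbasis (memvf v)) linear_sumr; apply: eq_bigr => j _.
by rewrite mxE linearZl_LR linearZr_LR scalerA.
Qed.

Lemma tensE (t : tensor) :
  t = \sum_(i < \dim {:U}) \sum_(j < \dim {:V}) t i j *: tens (vbasis {:U})`_i (vbasis {:V})`_j.
Proof.
have [freeU freeV] := (basis_free (vbasisP {:U}), basis_free (vbasisP {:V})).
rewrite [LHS]matrix_sum_delta; apply: eq_bigr => i _; apply: eq_bigr => j _.
congr (_ *: _); apply/matrixP=> i' j'.
by rewrite !mxE !coord_free // -natrM mulnb [i' == i]eq_sym [j' == j]eq_sym.
Qed.

Lemma tlift_uniq (W : vectType k) (f : U -> V -> W) (h : tensor -> W) :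
  linear h -> (forall u v, h (tens u v) = f u v) -> h =1 tlift f.
Proof.
move=> linh hf t.
pose H : {linear tensor -> W} := HB.pack h (GRing.isLinear.Build k _ _ *:%R h linh).
rewrite -[h t]/(H t) {1}(tensE t) linear_sum; apply: eq_bigr => i _.
by rewrite linear_sum; apply: eq_bigr => j _; rewrite linearZ -hf.
Qed.

Lemma tpairing_tens f g u v : tpairing f g (tens u v) = f u * g v.
Proof.
rewrite /tpairing tlift_tens // => [w c x y|w c x y].
  by rewrite linearP mulrDl -scalerAl.
by rewrite linearP mulrDr -scalerAr.
Qed.

Lemma tpairing_inj s t : (forall f g, tpairing f g s = tpairing f g t) -> s = t.
Proof.
pose cU i : dual U := linfun (coord (vbasis {:U}) i : U -> k^o).
pose cV j : dual V := linfun (coord (vbasis {:V}) j : V -> k^o).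
have E i j t' : tpairing (cU i) (cV j) t' = t' i j.
  pose ev (t' : tensor) : k^o := t' i j.
  rewrite -[RHS]/(ev t') /tpairing; apply/esym/tlift_uniq => [c x y|u v].
    by rewrite /ev !mxE.
  by rewrite /ev mxE !lfunE.
by move=> st; apply/matrixP=> i j; rewrite -!E.
Qed.

Lemma tensor_of_homP gamma f g :
  tpairing f g (tensor_of_hom gamma) = g (gamma f).
Proof.
rewrite linear_sum /=.
have {2}-> : f = \sum_(i < \dim {:U}) f (vbasis {:U})`_i *:
                   linfun (coord (vbasis {:U}) i : U -> k^o).
  apply/lfunP=> u; rewrite sum_lfunE {1}(coord_vbasis (memvf u)) linear_sum.
  by apply: eq_bigr => i _; rewrite linearZ scale_lfunE lfunE /= [LHS]mulrC.
rewrite !linear_sum; apply: eq_bigr => i _.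
by rewrite tpairing_tens !linearZ.
Qed.

End Tensor.

Arguments tens {k U V}.
Arguments tlift {k U V W}.
Arguments tpairing {k U V}.
Arguments tensor_of_hom {k U V}.

Notation "u ⊗ v" := (tens u v) (at level 41, right associativity) : ring_scope.

Section YangBaxter.
Variables (k : fieldType) (A : novikovType k).
Local Notation A2 := (tensor A A).
Local Notation A3 := (tensor A (tensor A A)).
Implicit Types r s : A2.

Definition tswap : A2 -> A2 := tlift (fun a b => b ⊗ a).

(* r_13 ∘ s_23 *)
Definition circ_13_23 r s : A3 :=
  tlift (fun x y => tlift (fun x' y' => x ⊗ x' ⊗ (y ∘ y')) s) r.

(* r_12 ⋆ s_23 *)
Definition star_12_23 r s : A3 :=
  tlift (fun x y => tlift (fun x' y' => x ⊗ (y ⋆ x') ⊗ y') s) r.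

(* r_13 ∘ s_12 *)
Definition circ_13_12 r s : A3 :=
  tlift (fun x y => tlift (fun x' y' => (x ∘ x') ⊗ y' ⊗ y) s) r.

Lemma tswap_tens a b : tswap (a ⊗ b) = b ⊗ a.
Proof.
by rewrite /tswap (tlift_tens _ (f := fun a b => b ⊗ a)) //;
   [exact: tens_linearr|exact: tens_linearl].
Qed.

Lemma tlift2_sum (W : vectType k) (f : A -> A -> A -> A -> W) (r s : seq (A * A)) :
  (forall y x' y', linear (fun x => f x y x' y')) ->
  (forall x x' y', linear (fun y => f x y x' y')) ->
  (forall x y y', linear (fun x' => f x y x' y')) ->
  (forall x y x', linear (f x y x')) ->
  tlift (fun x y => tlift (f x y) (\sum_(q <- s) q.1 ⊗ q.2))
        (\sum_(p <- r) p.1 ⊗ p.2) =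
  \sum_(p <- r) \sum_(q <- s) f p.1 p.2 q.1 q.2.
Proof.
move=> lin1 lin2 lin3 lin4.
have tlift_sum (g : A -> A -> W) (q : seq (A * A)) :
    (forall y, linear (g^~ y)) -> (forall x, linear (g x)) ->
    tlift g (\sum_(p <- q) p.1 ⊗ p.2) = \sum_(p <- q) g p.1 p.2.
  move=> gl gr.
  by rewrite linear_sum; apply: eq_bigr => p _; rewrite /= tlift_tens.
have Es x y : tlift (f x y) (\sum_(q <- s) q.1 ⊗ q.2) =
    \sum_(q <- s) f x y q.1 q.2 by rewrite tlift_sum.
rewrite tlift_sum => [|y c u v|x c u v]; first by apply: eq_bigr => p _.
  by rewrite !Es scaler_sumr -big_split; apply: eq_bigr => q _; rewrite lin1.
by rewrite !Es scaler_sumr -big_split; apply: eq_bigr => q _; rewrite lin2.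
Qed.

Lemma circ_13_23_sum (r s : seq (A * A)) :
  circ_13_23 (\sum_(p <- r) p.1 ⊗ p.2) (\sum_(q <- s) q.1 ⊗ q.2) =
  \sum_(p <- r) \sum_(q <- s) p.1 ⊗ q.1 ⊗ (p.2 ∘ q.2).
Proof.
rewrite /circ_13_23 tlift2_sum // => *; move=> c u v;
  by rewrite ?(linearPl, linearPr) ?(tens_linearl, tens_linearr).
Qed.

Lemma star_12_23_sum (r s : seq (A * A)) :
  star_12_23 (\sum_(p <- r) p.1 ⊗ p.2) (\sum_(q <- s) q.1 ⊗ q.2) =
  \sum_(p <- r) \sum_(q <- s) p.1 ⊗ (p.2 ⋆ q.1) ⊗ q.2.
Proof.
have star_linear a : linear (nov_star a) /\ linear ((@nov_star k A)^~ a).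
  by split=> c u v; rewrite /nov_star linearPl linearPr scalerDr addrACA.
rewrite /star_12_23 tlift2_sum // => *; move=> c u v;
  by rewrite ?((star_linear _).1, (star_linear _).2)
             ?(tens_linearl, tens_linearr) ?(tens_linearl, tens_linearr).
Qed.

Lemma circ_13_12_sum (r s : seq (A * A)) :
  circ_13_12 (\sum_(p <- r) p.1 ⊗ p.2) (\sum_(q <- s) q.1 ⊗ q.2) =
  \sum_(p <- r) \sum_(q <- s) (p.1 ∘ q.1) ⊗ q.2 ⊗ p.2.
Proof.
rewrite /circ_13_12 tlift2_sum // => *; move=> c u v;
  by rewrite ?(linearPl, linearPr) ?(tens_linearl, tens_linearr)
             ?(tens_linearl, tens_linearr).
Qed.

Definition extended_NYBE (epsilon : k) r : Prop :=
  circ_13_23 r r + star_12_23 r r + circ_13_12 r r =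
  epsilon *: circ_13_23 (r + tswap r) (r + tswap r).

Definition NYBE r : Prop := extended_NYBE 0 r.

End YangBaxter.

(* Main.v *)
(* The form identifies A with its dual and turns the coregular bimodule into the
   regular one, which gives (i).  For (ii), pair the Yang-Baxter equation of
   δ = T ± β with φ(a) ⊗ φ(b) ⊗ φ(c), where δ has adjoint δ' = -T ± β: invariance
   moves every term into B(c, -), leaving
     δa ∘ δb - δ(δa ∘ b) + δ(a ∘ δ'b) = ε (δ + δ')a ∘ (δ + δ')b.
   As β is balanced and a bimodule homomorphism, the mixed terms cancel and this is
     Ta ∘ Tb - T(Ta ∘ b + a ∘ Tb) + βa ∘ βb = 4 ε βa ∘ βb.
   The sign ± is absorbed by replacing β with -β. *)

Require Import Defs.
From HB Require Import structures.
From mathcomp Require Import all_boot all_order all_algebra ring.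

Set Implicit Arguments.
Unset Strict Implicit.
Unset Printing Implicit Defensive.

Import GRing.Theory.
Local Open Scope ring_scope.

(** * Partial evaluation of a tensor on one leg *)

Section Contraction.
Variables (k : fieldType) (U V : vectType k).
Local Notation dual V := 'Hom(V, k^o).

Lemma tensor_sum (t : tensor U V) :
  exists s : seq (U * V), t = \sum_(p <- s) p.1 ⊗ p.2.
Proof.
exists [seq (t p.1 p.2 *: (vbasis {:U})`_(p.1), (vbasis {:V})`_(p.2)) |
  p <- enum {: 'I_(\dim {:U}) * 'I_(\dim {:V})}].
rewrite big_map big_enum /= [LHS]tensE pair_bigA; apply: eq_bigr => p _ /=.
(* [tens_linearl] speaks of [c *: u + v]; taking 0 for the second vector leaves homogeneity, up to a
   summand [0 ⊗ v] that vanishes. *)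
have := tens_linearl (vbasis {:V})`_(p.2) (t p.1 p.2) (vbasis {:U})`_(p.1) 0.
rewrite !addr0 => ->.
suff -> : (0 : U) ⊗ (vbasis {:V})`_(p.2) = 0 by rewrite addr0.
by apply/matrixP=> i j; rewrite !mxE linear0 mul0r.
Qed.

(** The slice maps f ⊗ id and id ⊗ g. On the tensor of a map they return the map and its
    transpose. *)
Definition contractl (f : dual U) : tensor U V -> V := tlift (fun u v => f u *: v).
Definition contractr (g : dual V) : tensor U V -> U := tlift (fun u v => g v *: u).

HB.instance Definition _ (f : dual U) := GRing.Linear.on (contractl f).
HB.instance Definition _ (g : dual V) := GRing.Linear.on (contractr g).

Lemma contractl_sum f (s : seq (U * V)) :
  contractl f (\sum_(p <- s) p.1 ⊗ p.2) = \sum_(p <- s) f p.1 *: p.2.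
Proof.
rewrite (linear_sum (contractl f)); apply: eq_bigr => p _.
rewrite /= /contractl tlift_tens // => w c x y.
  by rewrite linearP scalerDl scalerA.
by rewrite scalerDr !scalerA mulrC.
Qed.

Lemma contractr_sum g (s : seq (U * V)) :
  contractr g (\sum_(p <- s) p.1 ⊗ p.2) = \sum_(p <- s) g p.2 *: p.1.
Proof.
rewrite (linear_sum (contractr g)); apply: eq_bigr => p _.
rewrite /= /contractr tlift_tens // => w c x y.
  by rewrite scalerDr !scalerA mulrC.
by rewrite linearP scalerDl scalerA.
Qed.

Lemma contractlP f (g : dual V) t : g (contractl f t) = tpairing f g t.
Proof.
have [s ->] := tensor_sum t; rewrite contractl_sum (linear_sum g).
rewrite (linear_sum (tpairing f g)).
by apply: eq_bigr => p _ /=; rewrite tpairing_tens linearZ.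
Qed.

Lemma contractrP (f : dual U) g t : f (contractr g t) = tpairing f g t.
Proof.
have [s ->] := tensor_sum t; rewrite contractr_sum (linear_sum f).
rewrite (linear_sum (tpairing f g)).
by apply: eq_bigr => p _ /=; rewrite tpairing_tens linearZ mulrC.
Qed.

Lemma tensor_of_homD : {morph @tensor_of_hom k U V : x y / x + y}.
Proof.
move=> x y; apply: tpairing_inj => f g.
by rewrite linearD /= !tensor_of_homP add_lfunE linearD.
Qed.

Lemma tensor_of_homN : {morph @tensor_of_hom k U V : x / - x}.
Proof.
move=> x; apply: tpairing_inj => f g.
by rewrite linearN /= !tensor_of_homP opp_lfunE linearN.
Qed.

End Contraction.

(** * Testing identities in A ⊗ A ⊗ A against triples of functionals *)

Section TripleTensor.
Variables (k : fieldType) (A : novikovType k).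
Local Notation dual V := 'Hom(V, k^o).
Implicit Types (f g h : dual A) (r s : tensor A A).

Definition tpairing3 f g h (t : tensor A (tensor A A)) : k^o :=
  tpairing g h (contractl f t).

HB.instance Definition _ f g h :=
  GRing.isLinear.Build k (tensor A (tensor A A)) k^o *:%R (tpairing3 f g h)
    (fun c x y => linearP (tpairing g h \o contractl f) c x y).

Lemma tpairing3_tens f g h x y z :
  tpairing3 f g h (x ⊗ y ⊗ z) = f x * (g y * h z).
Proof.
have := contractl_sum f [:: (x, y ⊗ z)]; rewrite !big_seq1 /tpairing3 => -> /=.
by rewrite linearZ /= tpairing_tens.
Qed.

(** Slicing off the first leg reduces separation of points to [tpairing_inj] on the remaining
    two. *)
Lemma tpairing3_inj (s t : tensor A (tensor A A)) :
  (forall f g h, tpairing3 f g h s = tpairing3 f g h t) -> s = t.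
Proof.
move=> st; apply: tpairing_inj => f G; rewrite -!contractlP; congr (G _).
by apply: tpairing_inj => g h; apply: st.
Qed.

Lemma contractl_tswap f r : contractl f (tswap r) = contractr f r.
Proof.
have [s ->] := tensor_sum r; rewrite contractr_sum.
have -> : tswap (\sum_(p <- s) p.1 ⊗ p.2) =
          \sum_(p <- [seq (p.2, p.1) | p <- s]) p.1 ⊗ p.2.
  rewrite big_map /tswap linear_sum.
  by apply: eq_bigr => p _; apply: tswap_tens.
by rewrite contractl_sum big_map.
Qed.

(** The leg common to both factors, here the third, carries the product; the functionals on the
    other two legs only slice [r] and [s]. The next two lemmas follow the same pattern, with common
    leg 2 and then 1. *)
Lemma tpairing3_circ_13_23 f g h r s :
  tpairing3 f g h (circ_13_23 r s) = h (contractl f r ∘ contractl g s).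
Proof.
have [[r' ->] [s' ->]] := (tensor_sum r, tensor_sum s).
rewrite circ_13_23_sum !contractl_sum (linear_sum (tpairing3 f g h)).
rewrite linear_sumlz (linear_sum h); apply: eq_bigr => p _ /=.
rewrite (linear_sum (tpairing3 f g h)) linear_sumr (linear_sum h).
apply: eq_bigr => q _ /=.
by rewrite tpairing3_tens linearZl_LR linearZr_LR !linearZ.
Qed.

Lemma tpairing3_star_12_23 f g h r s :
  tpairing3 f g h (star_12_23 r s) = g (contractl f r ⋆ contractr h s).
Proof.
have [[r' ->] [s' ->]] := (tensor_sum r, tensor_sum s).
rewrite star_12_23_sum contractl_sum contractr_sum (linear_sum (tpairing3 f g h)).
rewrite /nov_star linear_sumlz linear_sumr -big_split (linear_sum g).
apply: eq_bigr => p _ /=.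
rewrite (linear_sum (tpairing3 f g h)) linear_sumr linear_sumlz -big_split.
rewrite (linear_sum g); apply: eq_bigr => q _ /=.
rewrite tpairing3_tens !(linearZl_LR, linearZr_LR) /= [h _ *: (f _ *: _)]scalerA.
(* The two halves of ⋆ produce the scalars in opposite orders; once aligned, they factor out of the
   sum. *)
rewrite [h _ * f _]mulrC -scalerA -!scalerDr !linearZ.
by rewrite [g _ * _]mulrC.
Qed.

Lemma tpairing3_circ_13_12 f g h r s :
  tpairing3 f g h (circ_13_12 r s) = f (contractr h r ∘ contractr g s).
Proof.
have [[r' ->] [s' ->]] := (tensor_sum r, tensor_sum s).
rewrite circ_13_12_sum !contractr_sum (linear_sum (tpairing3 f g h)).
rewrite linear_sumlz (linear_sum f); apply: eq_bigr => p _ /=.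
rewrite (linear_sum (tpairing3 f g h)) linear_sumr (linear_sum f).
apply: eq_bigr => q _ /=.
rewrite tpairing3_tens linearZl_LR linearZr_LR !linearZ /=.
by rewrite mulrC -mulrA mulrCA.
Qed.

End TripleTensor.

(** * Transport along the form, and the Yang-Baxter equation as an operator identity *)

Section Quadratic.
Variables (k : fieldType) (A : novikovType k) (B : {symmetric A}).
Hypotheses (ndB : nondegenerate B) (invB : invariant_form B).
Local Notation phi := (form_map B).
Implicit Types (D : 'End(A)) (a b c : A).

Lemma formC a b : B a b = B b a.
Proof. by rewrite hermC expr0 mul1r. Qed.

Lemma form_map_surj (f : 'Hom(A, k^o)) : exists a, f = phi a.
Proof. by have [g _ gK] := form_map_bij ndB; exists (g f). Qed.

Lemma form_nondeg a b : (forall c, B c a = B c b) -> a = b.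
Proof.
move=> ab; apply: (bij_inj (form_map_bij ndB)); apply/lfunP=> c.
by rewrite !form_mapE formC ab formC.
Qed.

Lemma comp_form_mapV (V : vectType k) (D : 'Hom(A, V)) a :
  (D \o phi^-1)%VF (phi a) = D a.
Proof.
rewrite comp_lfunE lker0_lfunK //; apply/lker0P.
exact: bij_inj (form_map_bij ndB).
Qed.

(** By invariance both sides equal -B(c, a ⋆ b), as ⋆ is commutative: right multiplications are
    self-adjoint. *)
Lemma form_nov_mulr a b c : B a (b ∘ c) = B (a ∘ c) b.
Proof.
by rewrite formC invB formC [RHS]invB /nov_star addrC formC.
Qed.

(** Invariance makes -(L + R)(a) the adjoint of L(a). Together with [coregular_ract], this makes
    [phi] an isomorphism from the regular to the coregular bimodule. *)
Lemma coregular_lact a b : lact (coregular_bimodule A) a (phi b) = phi (a ∘ b).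
Proof.
apply/lfunP=> c; rewrite dual_repE !form_mapE 2!add_lfunE lmultE rmultE.
by rewrite invB.
Qed.

Lemma coregular_ract a b : ract (coregular_bimodule A) a (phi b) = phi (b ∘ a).
Proof.
apply/lfunP=> c; rewrite 3!opp_lfunE dual_repE opprK !form_mapE rmultE.
exact: form_nov_mulr.
Qed.

Lemma extended_O_operator_coregular kappa (beta T : 'End(A)) :
  extended_O_operator (regular_bimodule A) kappa beta T <->
  extended_O_operator (coregular_bimodule A) kappa
    (beta \o phi^-1)%VF (T \o phi^-1)%VF.
Proof.
have phiI := bij_inj (form_map_bij ndB).
split=> -[bal inv op]; split.
- move=> f g; have [[a ->] [b ->]] := (form_map_surj f, form_map_surj g).
  rewrite !comp_form_mapV coregular_lact coregular_ract; congr (phi _).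
  by have := bal a b; rewrite lmultE rmultE.
- move=> x f; have [a ->] := form_map_surj f.
  rewrite coregular_lact coregular_ract !comp_form_mapV.
  by have := inv x a; rewrite lmultE rmultE.
- move=> f g; have [[a ->] [b ->]] := (form_map_surj f, form_map_surj g).
  rewrite !comp_form_mapV coregular_lact coregular_ract -linearD comp_form_mapV.
  by have := op a b; rewrite lmultE rmultE.
(* Balance is an identity in the module, so its converse needs injectivity of [phi]; the other two
   conditions live in A and are only evaluated at [phi a]. *)
- move=> a b; rewrite lmultE rmultE; apply: phiI.
  by rewrite -coregular_lact -coregular_ract -!(comp_form_mapV beta) bal.
- move=> x a; have := inv x (phi a).
  by rewrite lmultE rmultE coregular_lact coregular_ract !comp_form_mapV.
- move=> a b; have := op (phi a) (phi b).
  rewrite lmultE rmultE !comp_form_mapV coregular_lact coregular_ract.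
  by rewrite -linearD comp_form_mapV.
Qed.

Lemma contractl_tensor_of_hom D a :
  contractl (phi a) (tensor_of_hom (D \o phi^-1)%VF) = D a.
Proof.
apply: form_nondeg => b; rewrite -form_mapE contractlP tensor_of_homP.
by rewrite comp_form_mapV form_mapE.
Qed.

(** Paired with [phi b], the right slice gives B(D b, a), and the adjoint moves [D] across. *)
Lemma contractr_tensor_of_hom D D' a :
  (forall b c, B (D b) c = B b (D' c)) ->
  contractr (phi a) (tensor_of_hom (D \o phi^-1)%VF) = D' a.
Proof.
move=> adj; apply: form_nondeg => b; rewrite -form_mapE contractrP tensor_of_homP.
by rewrite comp_form_mapV form_mapE formC adj.
Qed.

Lemma extended_NYBE_form_map epsilon D D' :
  (forall b c, B (D b) c = B b (D' c)) ->
  extended_NYBE epsilon (tensor_of_hom (D \o phi^-1)%VF) <->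
  (forall a b, D a ∘ D b - D (D a ∘ b) + D (a ∘ D' b) =
               epsilon *: ((D a + D' a) ∘ (D b + D' b))).
Proof.
move=> adj; set r := tensor_of_hom _.
have rl := contractl_tensor_of_hom D; have rr a := contractr_tensor_of_hom a adj.
have adj' b c : B b (D c) = B (D' b) c by rewrite formC adj formC.
have lhs a b c : tpairing3 (phi a) (phi b) (phi c)
    (circ_13_23 r r + star_12_23 r r + circ_13_12 r r) =
    B c (D a ∘ D b - D (D a ∘ b) + D (a ∘ D' b)).
  rewrite !linearD /= tpairing3_circ_13_23 tpairing3_star_12_23.
  rewrite tpairing3_circ_13_12.
  have formNr x y : B x (- y) = - B x y by rewrite linearNr.
  (* The first terms agree. The ⋆ term is B(b, Da ⋆ D'c) = -B(Da ∘ b, D'c) by invariance; the last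
     is B(a, D'c ∘ D'b) = B(a ∘ D'b, D'c) by self-adjointness of right multiplication. *)
  rewrite !rl !rr !form_mapE formNr !adj'; congr (_ + _ + _).
    by rewrite [in RHS]formC invB opprK.
  by rewrite form_nov_mulr formC.
have rhs a b c : tpairing3 (phi a) (phi b) (phi c)
    (epsilon *: circ_13_23 (r + tswap r) (r + tswap r)) =
    B c (epsilon *: ((D a + D' a) ∘ (D b + D' b))).
  (* The swap exchanges left and right slices, so those of [r + tswap r] are given by [D + D']. *)
  rewrite linearZ /= tpairing3_circ_13_23 !linearD /= !contractl_tswap !rl !rr.
  by rewrite form_mapE linearZr.
split=> [E a b|E].
  by apply: form_nondeg => c; rewrite -lhs E rhs.
apply: tpairing3_inj => f g h.
have [[a ->] [b ->]] := (form_map_surj f, form_map_surj g).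
have [c ->] := form_map_surj h.
by rewrite lhs rhs E.
Qed.

Lemma extended_NYBE_add kappa (T beta : 'End(A)) :
  4%:R != 0 :> k ->
  balanced (regular_bimodule A) beta -> bimodule_hom (regular_bimodule A) beta ->
  self_adjoint B beta -> skew_adjoint B T ->
  extended_NYBE ((kappa + 1) / 4%:R)
    (tensor_of_hom (T \o phi^-1)%VF + tensor_of_hom (beta \o phi^-1)%VF) <->
  extended_O_operator (regular_bimodule A) kappa beta T.
Proof.
move=> nz4 bal hom sa ska.
have balE a b : beta a ∘ b = a ∘ beta b by have := bal a b; rewrite lmultE rmultE.
have [homl homr] : (forall x u, beta (x ∘ u) = x ∘ beta u) /\
                   (forall x u, beta (u ∘ x) = beta u ∘ x).
  by split=> x u; have := hom x u; rewrite lmultE rmultE; case.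
have adj b c : B ((T + beta) b) c = B b ((beta - T) c).
  rewrite !add_lfunE opp_lfunE linearDl linearDr /= sa ska addrC.
  by congr (_ + _); rewrite linearNr.
rewrite -tensor_of_homD -comp_lfunDl.
apply: (iff_trans (extended_NYBE_form_map _ adj)).
have mulDl (x y z : A) : (x + y) ∘ z = x ∘ z + y ∘ z by rewrite linearDl.
have mulDr (x y z : A) : x ∘ (y + z) = x ∘ y + x ∘ z by rewrite linearDr.
have mulNr (x y : A) : x ∘ - y = - (x ∘ y) by rewrite linearNr.
have E a b :
    (T + beta) a ∘ (T + beta) b - (T + beta) ((T + beta) a ∘ b)
      + (T + beta) (a ∘ (beta - T) b) =
    T a ∘ T b - T (T a ∘ b + a ∘ T b) + beta a ∘ beta b.
  (* Balance cancels T(βa ∘ b) against T(a ∘ βb), and likewise under β; the homomorphism property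
     cancels β(Ta ∘ b) against Ta ∘ βb and β(a ∘ Tb) against βa ∘ Tb. *)
  have [balTr homT] := (balE a b, (homl (T a) b, homr (T b) a)).
  rewrite !add_lfunE !opp_lfunE.
  rewrite !(mulDr, mulDl, mulNr, linearD, linearN) /= balTr homT homl homr.
  apply: coord_inj => i; rewrite !(linearD, linearN) /=; ring.
have F a b :
    ((kappa + 1) / 4%:R) *:
      (((T + beta) a + (beta - T) a) ∘ ((T + beta) b + (beta - T) b)) =
    kappa *: (beta a ∘ beta b) + beta a ∘ beta b.
  (* The operator and its adjoint add up to 2β; the resulting factor 4 cancels the denominator of
     the mass. *)
  have D x : (T + beta) x + (beta - T) x = 2%:R *: beta x.
    by rewrite !add_lfunE opp_lfunE addrC addrA subrK -mulr2n scaler_nat.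
  rewrite !D linearZl_LR linearZr_LR !scalerA -mulrA -natrM.
  by rewrite divfK // scalerDl scale1r.
split=> [eq|[_ _ op] a b].
  split=> // [x u|u v]; first by have [-> ->] := hom x u.
  by apply: (addIr (beta u ∘ beta v)); rewrite -F -eq E lmultE rmultE.
by rewrite E F -op lmultE rmultE.
Qed.

End Quadratic.

(** * Change of sign of β, and the special masses *)

Lemma extended_O_operatorN (k : fieldType) (A : novikovType k) (V : vectType k)
    (M : bimodule A V) kappa (beta alpha : 'Hom(V, A)) :
  extended_O_operator M kappa beta alpha ->
  extended_O_operator M kappa (- beta) alpha.
Proof.
(* The conditions on β alone are linear in it and the operator equation is quadratic, so the sign
   drops out. *)
move=> [bal inv op]; split.
- by move=> u v; rewrite !opp_lfunE !linearN !opp_lfunE bal.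
- move=> x u; have [l r] := inv x u.
  by rewrite !opp_lfunE linearNr linearNl !scalerN l r.
- by move=> u v; rewrite !opp_lfunE linearNr linearNl opprK.
Qed.


Theorem proposition3p13 (k : fieldType) (char0 : [pchar k] =i pred0)
    (A : novikovType k) (B : {symmetric A})
    (ndB : nondegenerate B) (invB : invariant_form B)
    (kappa : k) (T beta : 'End(A))
    (balanced_beta : balanced (regular_bimodule A) beta)
    (hom_beta : bimodule_hom (regular_bimodule A) beta)
    (self_adj_beta : self_adjoint B beta) :
  let P_T := (T \o (form_map B)^-1)%VF in
  let P_beta := (beta \o (form_map B)^-1)%VF in
  (extended_O_operator (regular_bimodule A) kappa beta T <->
   extended_O_operator (coregular_bimodule A) kappa P_beta P_T)
  /\
  (skew_adjoint B T ->
   forall delta : tensor A A,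
     delta = tensor_of_hom P_T + tensor_of_hom P_beta \/
     delta = tensor_of_hom P_T - tensor_of_hom P_beta ->
   [/\ extended_NYBE ((kappa + 1) / 4%:R) delta <->
         extended_O_operator (regular_bimodule A) kappa beta T,
       kappa = -1 ->
         (NYBE delta <-> extended_O_operator (regular_bimodule A) (-1) beta T)
     & kappa = 0 ->
         (extended_NYBE (1 / 4%:R) delta <-> rota_baxter T) /\
         ((forall x y, beta x ∘ beta y = 0) -> (NYBE delta <-> rota_baxter T))]).
Proof.
move=> P_T P_beta; split; first exact: extended_O_operator_coregular.
move=> ska delta deltaE.
have nz4 : 4%:R != 0 :> k by rewrite ((pcharf0P k).1 char0).
(* The tensor [delta] does not involve the mass, so the equivalence is proved for every [kap] and
   then used at -1 and 0. *)
have main kap : extended_NYBE ((kap + 1) / 4%:R) delta <->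
                extended_O_operator (regular_bimodule A) kap beta T.
  case: deltaE => ->; first exact: extended_NYBE_add.
  rewrite -tensor_of_homN /P_beta -comp_lfunNl.
  apply: (iff_trans (extended_NYBE_add ndB invB kap nz4 _ _ _ ska)).
  - by move=> u v; rewrite !opp_lfunE !linearN !opp_lfunE balanced_beta.
  - move=> x u; have [l r] := hom_beta x u.
    by rewrite !opp_lfunE l r linearNr linearNl.
  - by move=> a b; rewrite !opp_lfunE linearNl linearNr /= self_adj_beta.
  - by split=> /extended_O_operatorN //; rewrite opprK.
have main0 : NYBE delta <-> extended_O_operator (regular_bimodule A) (-1) beta T.
  by rewrite -main addNr mul0r.
(* Once the extension term vanishes, only the Rota-Baxter identity remains; the conditions on β hold
   by hypothesis. *)
have rb kap : (forall x y, kap *: (beta x ∘ beta y) = 0) ->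
    rota_baxter T <-> extended_O_operator (regular_bimodule A) kap beta T.
  move=> beta0; split=> [rbT|[_ _ op] x y].
    split=> // [x u|u v]; first by have [-> ->] := hom_beta x u.
    by rewrite lmultE rmultE beta0 rbT subrr.
  by have /eqP := op x y; rewrite lmultE rmultE beta0 subr_eq0 => /eqP.
split=> // kappaE.
(* At κ = 0 the Yang-Baxter mass is 1/4. Mass 0 corresponds to κ = -1, where β ∘ β = 0 again reduces
   the operator equation to Rota-Baxter. *)
split; first by rewrite (rb 0) -?main ?add0r // => x y; rewrite scale0r.
by move=> beta0; rewrite (rb (-1)) // => x y; rewrite beta0 scaler0.
Qed.
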